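(* Let $m,N,d_1,d_2\ge 1$ be integers, let $\theta:[m]\to[m]$ be a bijection, and let $\sigma$ (a permutation of $[2m]$) and $\tau$ (a partial permutation of $[2m]$) be the associated maps defined in the context. If $\theta$ is crossing, then $$\max_{\|A_1\|,\ldots,\|A_{2m}\|\le 1}\left\|\left(\mathrm{Tr}_\sigma^{\otimes d_1}\otimes\mathrm{Tr}_\tau^{\otimes d_2}\right)(A_1,\ldots,A_{2m})\right\| \le N^{d_1m+\min\{d_1,d_2\}},$$ where the maximum is over $A_1,\ldots,A_{2m}\in M_N(\mathbb{C})^{\otimes(d_1+d_2)}$ with operator norm at most $1$.
   Context: $[n]=\{1,\ldots,n\}$. Given the bijection $\theta:[m]\to[m]$, define permutations $\sigma',\sigma''$ of $[m]$ by $\sigma'(i)=\theta(i)+1 \pmod m$ (values taken in $[m]$) and $\sigma''(\theta(i))=i$. Define the permutation $\sigma$ of $[2m]$ by $\sigma(2i-1)=2\sigma'(i)-1$ and $\sigma(2i)=2\sigma''(i)$ for $i\in[m]$. Let $\tau$ be the partial permutation of $[2m]$ with domain $D(\tau)=[2m-1]$ and $\tau(i)=i+1$. Let $\tilde\theta$ be the pairing of $[2m]$ with pairs $\{2i-1,2\theta(i)\}$, $i\in[m]$. $\theta$ is called non-crossing if $\tilde\theta$ is a non-crossing pairing, i.e. there are no two pairs $\{a,b\},\{c,d\}$ of $\tilde\theta$ with $a<c<b<d$; otherwise $\theta$ is crossing. Partial trace: a partial permutation $\rho$ of $[n]$ is an injective map $\rho:D(\rho)\to[n]$ with $D(\rho)\subseteq[n]$,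 image $\mathrm{Im}(\rho)$. For partial permutations $\rho_1,\ldots,\rho_k$ of $[n]$ and $A_1,\ldots,A_n\in M_N(\mathbb{C})^{\otimes k}$ (rows and columns indexed by $[N]^k$), $Y=(\mathrm{Tr}_{\rho_1}\otimes\cdots\otimes\mathrm{Tr}_{\rho_k})(A_1,\ldots,A_n)$ is the matrix with rows indexed by $a\in[N]^{\{(i,j):\,i\notin\mathrm{Im}(\rho_j)\}}$, columns indexed by $b\in[N]^{\{(i,j):\,i\notin D(\rho_j)\}}$, and $$Y_{a,b}=\sum\prod_{i=1}^n(A_i)_{(r_{i,1},\ldots,r_{i,k}),(c_{i,1},\ldots,c_{i,k})},$$ summed over all $r,c\in[N]^{[n]\times[k]}$ with $r_{\rho_j(i),j}=c_{i,j}$ for $i\in D(\rho_j)$, $r_{i,j}=a_{i,j}$ for $i\notin\mathrm{Im}(\rho_j)$, and $c_{i,j}=b_{i,j}$ for $i\notin D(\rho_j)$. $\mathrm{Tr}_\sigma^{\otimes d_1}\otimes\mathrm{Tr}_\tau^{\otimes d_2}$ is the case $n=2m$, $k=d_1+d_2$, $\rho_1=\cdots=\rho_{d_1}=\sigma$, $\rho_{d_1+1}=\cdots=\rho_{d_1+d_2}=\tau$; its values are matrices of size $N^{d_2}$. $\|\cdot\|$ is the operator norm. *)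

(* Defs.v *)
(* The set [n] = {1, ..., n} is rendered as 'I_n = {0, ..., n-1}: the ordinal
   [i] stands for the integer [i + 1]. *)
From HB Require Import structures.
From mathcomp Require Import all_boot all_order all_algebra all_fingroup.
From mathcomp Require Import zify.
From mathcomp Require Import boolp classical_sets reals.
From mathcomp Require Import complex.

Set Implicit Arguments.
Unset Strict Implicit.
Unset Printing Implicit Defensive.

Import Order.TTheory GRing.Theory Num.Theory.

Local Open Scope ring_scope.

Section OperatorNorm.
Variable R : realType.

Definition l2norm n (x : 'cV[R[i]]_n) : R :=
  Num.sqrt (\sum_(i < n) ComplexField.Normc.normc (x i 0) ^+ 2).

Definition opnorm p q (A : 'M[R[i]]_(p, q)) : R :=
  sup [set l2norm (A *m x) | x in [set x : 'cV[R[i]]_q | l2norm x <= 1]]%classic.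

End OperatorNorm.

(* A map defined on a part of 'I_n; [None] means "outside of the domain". *)
Record pperm (n : nat) := PPerm {
  pp_fun :> 'I_n -> option 'I_n;
  pp_inj : forall i1 i2 j,
    pp_fun i1 = Some j -> pp_fun i2 = Some j -> i1 = i2
}.

Definition pdom n (rho : pperm n) : {set 'I_n} := [set i | rho i != None].

Definition pim n (rho : pperm n) : {set 'I_n} :=
  [set i' | [exists i, rho i == Some i']].

Lemma pperm_of_perm_subproof n (s : 'S_n) i1 i2 j :
  Some (s i1) = Some j -> Some (s i2) = Some j -> i1 = i2.
Proof. by move=> [<-] [] /perm_inj. Qed.

Definition pperm_of_perm n (s : 'S_n) : pperm n :=
  PPerm (@pperm_of_perm_subproof n s).

Section PartialTrace.
Variables (C : comNzRingType) (N k : nat).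

Definition multi_index : finType := {ffun 'I_k -> 'I_N}.

(* M_N(C) to the k-th tensor power, that is, the square matrices indexed by
   [N]^k; the latter is enumerated by [enum_rank]. *)
Definition tensor_mx := 'M[C]_#|multi_index|.

Definition tentry (A : tensor_mx) (r c : multi_index) : C :=
  A (enum_rank r) (enum_rank c).

Variables (n : nat) (rho : 'I_k -> pperm n).

Definition free_row : {set 'I_n * 'I_k} := [set x | x.1 \notin pim (rho x.2)].
Definition free_col : {set 'I_n * 'I_k} := [set x | x.1 \notin pdom (rho x.2)].

Definition row_index : finType := {ffun {x | x \in free_row} -> 'I_N}.
Definition col_index : finType := {ffun {x | x \in free_col} -> 'I_N}.

Definition ptrace_compat (a : row_index) (b : col_index)
    (r c : {ffun 'I_n * 'I_k -> 'I_N}) : bool :=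
  [&& [forall j, forall i, forall i',
         (rho j i == Some i') ==> (r (i', j) == c (i, j))],
      [forall x, r (val x) == a x]
    & [forall x, c (val x) == b x]].

Definition ptrace (A : 'I_n -> tensor_mx) :
    'M[C]_(#|row_index|, #|col_index|) :=
  \matrix_(a, b)
    \sum_(rc : {ffun 'I_n * 'I_k -> 'I_N} * {ffun 'I_n * 'I_k -> 'I_N}
          | ptrace_compat (enum_val a) (enum_val b) rc.1 rc.2)
      \prod_(i < n) tentry (A i) [ffun j => rc.1 (i, j)] [ffun j => rc.2 (i, j)].

End PartialTrace.

Section AssociatedMaps.
Variable m : nat.

Lemma odd_pos_subproof (i : 'I_m) : (2 * i < 2 * m)%N.
Proof. by have := ltn_ord i; lia. Qed.

Lemma even_pos_subproof (i : 'I_m) : ((2 * i).+1 < 2 * m)%N.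
Proof. by have := ltn_ord i; lia. Qed.

Lemma half_pos_subproof (x : 'I_(2 * m)) : (x./2 < m)%N.
Proof. by have := ltn_ord x; lia. Qed.

(* When [i] stands for the integer [i + 1], these stand for [2(i + 1) - 1] and
   [2(i + 1)]; [half_pos] is the inverse of both. *)
Definition odd_pos (i : 'I_m) : 'I_(2 * m) := Ordinal (odd_pos_subproof i).
Definition even_pos (i : 'I_m) : 'I_(2 * m) := Ordinal (even_pos_subproof i).
Definition half_pos (x : 'I_(2 * m)) : 'I_m := Ordinal (half_pos_subproof x).

Variable theta : 'S_m.

(* [ordS] is the cyclic successor of 'I_m. *)
Definition sigma' (i : 'I_m) : 'I_m := ordS (theta i).
Definition sigma'' (i : 'I_m) : 'I_m := (theta^-1)%g i.

Definition sigma_fun (x : 'I_(2 * m)) : 'I_(2 * m) :=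
  if odd x then even_pos (sigma'' (half_pos x))
  else odd_pos (sigma' (half_pos x)).

Lemma sigma_fun_inj : injective sigma_fun.
Proof.
move=> x y; rewrite /sigma_fun.
have val_half (z : 'I_(2 * m)) : nat_of_ord z = (odd z + 2 * half_pos z)%N.
  by have := odd_double_half z; rewrite -mul2n /= => ->.
case ox: (odd x); case oy: (odd y) => /(congr1 val) /= exy; try lia.
- have /val_inj/perm_inj hxy :
    val (sigma'' (half_pos x)) = val (sigma'' (half_pos y)) by rewrite /=; lia.
  by apply: val_inj; rewrite /= (val_half x) (val_half y) ox oy hxy.
- have /val_inj/ordS_inj/perm_inj hxy :
    val (sigma' (half_pos x)) = val (sigma' (half_pos y)) by rewrite /=; lia.
  by apply: val_inj; rewrite /= (val_half x) (val_half y) ox oy hxy.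
Qed.

Definition sigma : 'S_(2 * m) := perm sigma_fun_inj.

(* [insub] yields [None] exactly when [i.+1] is not smaller than [2 * m]. *)
Definition tau_fun (i : 'I_(2 * m)) : option 'I_(2 * m) := insub i.+1.

Lemma tau_fun_inj i1 i2 j :
  tau_fun i1 = Some j -> tau_fun i2 = Some j -> i1 = i2.
Proof.
rewrite /tau_fun; case: insubP => // u _ eu [<-]; case: insubP => // v _ ev [evu].
by apply/val_inj/succn_inj; rewrite -[LHS]eu -[RHS]ev evu.
Qed.

Definition tau : pperm (2 * m) := PPerm tau_fun_inj.

Definition pairing : {set {set 'I_(2 * m)}} :=
  [set [set odd_pos i; even_pos (theta i)] | i : 'I_m].

End AssociatedMaps.

Definition crossing_pairing n (P : {set {set 'I_n}}) : Prop :=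
  exists a b c d : 'I_n,
    [/\ [set a; b] \in P, [set c; d] \in P & (a < c < b)%N && (b < d)%N].

Definition crossing m (theta : 'S_m) : Prop := crossing_pairing (pairing theta).

(* The family of partial permutations defining the product of [d1] copies of
   [Tr_sigma] and [d2] copies of [Tr_tau], the former coming first. *)
Definition sigma_tau_family m (theta : 'S_m) (d1 d2 : nat)
    (j : 'I_(d1 + d2)) : pperm (2 * m) :=
  if (j < d1)%N then pperm_of_perm (sigma theta) else tau m.
Arguments sigma_tau_family {m} theta d1 d2 j.

(* Main.v *)
(* For any family [rho] of partial permutations and any ordering of the matrices
   A_1, ..., A_n, the partial trace is a circuit in which the A_i act in turn on
   wires carrying C^N. An arc from a column slot of A_i to a row slot of A_i' is
   an honest wire when A_i' acts before A_i; otherwise it is "backward", and one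
   sums over its N values, which costs a factor N. Hence the operator norm is at
   most N^(number of backward arcs), whatever the ordering.

   In the natural ordering, [tau] has no backward arc and [sigma] has at most
   m + 1 of them. If {a, b} and {c, d} are crossing pairs with a < c < b < d, the
   ordering 1..a, c+1..b, a+1..c, b+1..2m creates one backward arc of [tau], and
   the pair {a, b} no longer contributes to those of [sigma], which are then at
   most m. The exponents are thus d1 (m + 1) and d1 m + d2. *)
Require Import Defs.
From mathcomp Require Import all_boot all_order all_algebra all_fingroup.
From mathcomp Require Import zify ring lra.
From mathcomp Require Import classical_sets reals complex.

Set Implicit Arguments.
Unset Strict Implicit.
Unset Printing Implicit Defensive.

Import Order.TTheory GRing.Theory Num.Theory.

Local Open Scope ring_scope.

(** * Assignments of values to wires *)

Section Wires.
Variable T : finType.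

Definition pull (K W : finType) (e : K -> W) (x : {ffun W -> T}) :
  {ffun K -> T} := [ffun j => x (e j)].

Definition setw (K W : finType) (e : K -> W) (g : {ffun K -> T})
    (x : {ffun W -> T}) : {ffun W -> T} :=
  [ffun w => if [pick j | e j == w] is Some j then g j else x w].

Lemma setw_in (K W : finType) (e : K -> W) g x j :
  injective e -> setw e g x (e j) = g j.
Proof.
move=> einj; rewrite ffunE; case: pickP => [j' /eqP/einj ->//|/(_ j)].
by rewrite eqxx.
Qed.

Lemma setw_out (K W : finType) (e : K -> W) g x w :
  (forall j, e j != w) -> setw e g x w = x w.
Proof.
by move=> ew; rewrite ffunE; case: pickP => // j; rewrite (negbTE (ew j)).
Qed.

Lemma pull_setw (K W : finType) (e : K -> W) g x :
  injective e -> pull e (setw e g x) = g.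
Proof. by move=> einj; apply/ffunP=> j; rewrite ffunE setw_in. Qed.

Lemma pull_setw_out (K K' W : finType) (e : K -> W) (e' : K' -> W) g x :
  (forall j j', e j != e' j') -> pull e' (setw e g x) = pull e' x.
Proof. by move=> ee'; apply/ffunP=> j; rewrite [LHS]ffunE setw_out ?ffunE. Qed.

Lemma setw_setw (K W : finType) (e : K -> W) g g' x :
  setw e g (setw e g' x) = setw e g x.
Proof. by apply/ffunP=> w; rewrite !ffunE; case: pickP. Qed.

Lemma setw_pull (K W : finType) (e : K -> W) x : setw e (pull e x) x = x.
Proof.
by apply/ffunP=> w; rewrite !ffunE; case: pickP => // j /eqP <-; rewrite ffunE.
Qed.

Lemma setwC (K K' W : finType) (e : K -> W) (e' : K' -> W) g g' x :
  (forall j j', e j != e' j') ->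
  setw e g (setw e' g' x) = setw e' g' (setw e g x).
Proof.
move=> ee'; apply/ffunP=> w; rewrite !ffunE.
case: pickP => [j /eqP <-|_].
  by case: pickP => // j' /eqP e'j'; move: (ee' j j'); rewrite e'j' eqxx.
by case: pickP.
Qed.

(* The map [(x, g) |-> (setw e g x, pull e x)] is an involution. *)
Lemma sum_setw (V : nmodType) (K W : finType) (e : K -> W)
    (f : {ffun K -> T} -> {ffun K -> T} -> {ffun W -> T} -> V) :
  injective e ->
  \sum_x \sum_g f (pull e x) g (setw e g x) = \sum_x \sum_g f g (pull e x) x.
Proof.
move=> einj; rewrite !pair_big /=.
pose h (p : {ffun W -> T} * {ffun K -> T}) := (setw e p.2 p.1, pull e p.1).
have hK : involutive h.
  by case=> x g; rewrite /h /= setw_setw setw_pull pull_setw.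
rewrite [RHS](reindex_inj (inv_inj hK)) /=; apply: eq_bigr => -[x g] _ /=.
by rewrite pull_setw.
Qed.

(** Every assignment arises as [setw e g x] from exactly #|{ffun K -> T}| pairs [(x, g)]. Averaging
    in this way stands in for splitting the wires into those of [e] and the rest. *)
Lemma sum_setw_const (V : nmodType) (K W : finType) (e : K -> W)
    (f : {ffun W -> T} -> V) : injective e ->
  \sum_x \sum_g f (setw e g x) = (\sum_x f x) *+ #|{ffun K -> T}|.
Proof.
move=> einj; rewrite (sum_setw (fun _ _ => f)) // -sumrMnl.
by apply: eq_bigr => x _; rewrite sumr_const.
Qed.

(** All [g] have equally many extensions to [W]; the two cardinals avoid a division. *)
Lemma sum_pull (V : nmodType) (K W : finType) (e : K -> W)
    (f : {ffun K -> T} -> V) : injective e ->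
  (\sum_x f (pull e x)) *+ #|{ffun K -> T}| = (\sum_g f g) *+ #|{ffun W -> T}|.
Proof.
move=> einj; rewrite -(sum_setw_const (e := e) (fun x => f (pull e x))) //.
rewrite -sumr_const; apply: eq_bigr => x _; apply: eq_bigr => g _.
by rewrite pull_setw.
Qed.

End Wires.

(** * Squared moduli and the Cauchy-Schwarz inequality *)

Section SquaredNorm.
Variable R : realType.
Implicit Types z : R[i].

Definition sqn z : R := ComplexField.Normc.normc z ^+ 2.

Lemma sqn_ge0 z : 0 <= sqn z. Proof. exact: sqr_ge0. Qed.

Lemma sqn0 : sqn 0 = 0.
Proof. by rewrite /sqn ComplexField.Normc.normc0 expr0n. Qed.

Lemma sqnM z z' : sqn (z * z') = sqn z * sqn z'.
Proof. by rewrite /sqn ComplexField.Normc.normcM exprMn. Qed.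

Lemma normc_sum (I : finType) (f : I -> R[i]) :
  ComplexField.Normc.normc (\sum_i f i)
    <= \sum_i ComplexField.Normc.normc (f i).
Proof.
elim/big_ind2: _ => [|x a y b ha hb|//].
  by rewrite ComplexField.Normc.normc0.
by apply: le_trans (lerD ha hb); apply: le_normcD.
Qed.

Lemma normc_ge0 z : 0 <= ComplexField.Normc.normc z.
Proof. by case: z => a b; apply: sqrtr_ge0. Qed.

Lemma sqr_sum_le (I : finType) (f : I -> R) :
  (\sum_i f i) ^+ 2 <= #|I|%:R * \sum_i f i ^+ 2.
Proof.
(* Lagrange's identity: this sum is twice the difference of the two sides. *)
have : 0 <= \sum_i \sum_j (f i - f j) ^+ 2.
  by apply: sumr_ge0 => i _; apply: sumr_ge0 => j _; apply: sqr_ge0.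
have -> : \sum_i \sum_j (f i - f j) ^+ 2 =
    2 * (#|I|%:R * \sum_i f i ^+ 2) - 2 * (\sum_i f i) ^+ 2.
  transitivity (\sum_i (#|I|%:R * f i ^+ 2 + \sum_j f j ^+ 2
                        - 2 * (\sum_j f j) * f i)).
    apply: eq_bigr => i _; rewrite mulrAC [_ * (\sum_j f j)]mulr_sumr.
    rewrite mulr_natl -sumr_const -big_split -sumrB /=.
    by apply: eq_bigr => j _; ring.
  rewrite sumrB big_split /= -!mulr_sumr sumr_const -[_ *+ #|I|]mulr_natl.
  by rewrite (_ : #|I| = #|{: I}|) //; ring.
lra.
Qed.

Lemma sqn_sum_le (I : finType) (f : I -> R[i]) :
  sqn (\sum_i f i) <= #|I|%:R * \sum_i sqn (f i).
Proof.
apply: le_trans (sqr_sum_le _); rewrite /sqn ler_sqr ?normc_sum //.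
  by rewrite nnegrE normc_ge0.
by rewrite nnegrE sumr_ge0 // => i _; apply: normc_ge0.
Qed.

End SquaredNorm.

(** * Circuits of contractions *)

Section Circuit.
Variables (R : realType) (T K W I : finType).
Variable A : I -> {ffun K -> T} -> {ffun K -> T} -> R[i].
Variables row col : I -> K -> W.

Hypothesis A_contr : forall i (f : {ffun K -> T} -> R[i]),
  \sum_r sqn (\sum_c A i r c * f c) <= \sum_c sqn (f c).
Hypothesis row_inj : forall i i' j j', row i j = row i' j' -> (i, j) = (i', j').
Hypothesis col_inj : forall i i' j j', col i j = col i' j' -> (i, j) = (i', j').

Let state := {ffun W -> T} -> R[i].

(** [A i] takes its input from the wires [col i] and delivers its output on [row i]. States are
    functions of all the wires, live or not, so that all gates act on one space. *)
Definition gate i (z : state) : state :=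
  fun x => \sum_g A i (pull (row i) x) g * z (setw (col i) g x).

(** The head of [s] is applied last: as in a product of matrices, gates later in [s] act first. *)
Definition circuit (s : seq I) (z : state) : state := foldr gate z s.

Let rowi_inj i : injective (row i).
Proof. by move=> j j' /row_inj[]. Qed.
Let coli_inj i : injective (col i).
Proof. by move=> j j' /col_inj[]. Qed.

(* Both sides are averaged: the left one over the values of the output wires of
   [A i], of which [z] is independent, the right one over those of its input
   wires. *)
Lemma gate_contr i (z : state) :
    (forall j j', row i j != col i j') ->
    (forall g x, z (setw (row i) g x) = z x) ->
  (0 < #|{ffun K -> T}|)%N ->
  \sum_x sqn (gate i z x) <= \sum_x sqn (z x).
Proof.
move=> rc zr K0; rewrite -(ler_pMn2r K0).
rewrite -(sum_setw_const (fun x => sqn (gate i z x)) (@rowi_inj i)).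
rewrite -(sum_setw_const (fun x => sqn (z x)) (@coli_inj i)).
apply: ler_sum => x _; apply: le_trans (A_contr i _); apply: ler_sum => r _.
rewrite le_eqVlt; apply/orP; left; apply/eqP; congr sqn.
by apply: eq_bigr => c _; rewrite pull_setw // -setwC // zr.
Qed.

Definition indep i (z : state) := forall x x' : {ffun W -> T},
  (forall w, (forall j, row i j != w) -> x w = x' w) -> z x = z x'.

Lemma indep_setw i z g x : indep i z -> z (setw (row i) g x) = z x.
Proof. by apply=> w; apply: setw_out. Qed.

Lemma circuit_indep s i (z : state) :
  i \notin s -> indep i z -> indep i (circuit s z).
Proof.
move=> + zr; elim: s => [|i' s IHs] //=; rewrite inE negb_or => /andP[ii' is'].
move=> x x' xx'; apply: eq_bigr => c _; congr (A _ _ _ * _).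
  apply/ffunP=> j; rewrite !ffunE; apply: xx' => j'.
  by apply: contraNneq ii' => /row_inj[->].
by apply: IHs => // w /xx' xw; rewrite !ffunE xw.
Qed.

Variable pos : I -> nat.
Hypothesis row_col : forall i i' j j',
  row i j = col i' j' -> (pos i' < pos i)%N.

Let row_coli i i' j j' : (pos i <= pos i')%N -> row i j != col i' j'.
Proof. by rewrite leqNgt; apply: contraNneq => /row_col. Qed.

Lemma circuit_contr s (z : state) :
    uniq s -> (forall i, indep i z) -> (0 < #|{ffun K -> T}|)%N ->
  \sum_x sqn (circuit s z x) <= \sum_x sqn (z x).
Proof.
move=> + zr K0; elim: s => [|i s IHs] //= /andP[is_ /IHs]; apply: le_trans.
apply: gate_contr => // [j j'|g x]; first exact: row_coli.
by rewrite indep_setw //; apply: circuit_indep.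
Qed.

Definition slot (i : I) (j : K) := (i, j).

Definition setcols (s : seq I) (c : {ffun I * K -> T}) (x : {ffun W -> T}) :=
  foldl (fun x i => setw (col i) (pull (slot i) c) x) x s.

Lemma setcols_pull_row s c x i :
  all (fun i' => pos i <= pos i')%N s ->
  pull (row i) (setcols s c x) = pull (row i) x.
Proof.
elim: s x => [|i' s IHs] x //= /andP[ii' /IHs ->].
by rewrite pull_setw_out // => j j'; rewrite eq_sym row_coli.
Qed.

Lemma setcols_setw s c x i g :
  i \notin s -> setcols s (setw (slot i) g c) x = setcols s c x.
Proof.
elim: s x => [|i' s IHs] x //=; rewrite inE negb_or => /andP[ii' is_].
rewrite IHs // pull_setw_out // => j j'.
by apply: contraNneq ii' => -[->].
Qed.

(** The summation variables of the gates are gathered into one [c]. Its values at gates outside [s]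
    are idle, whence the two multiplicities. Sortedness ensures that writing the inputs of later
    gates of [s] leaves the outputs of earlier ones intact. *)
Lemma circuitE s (z : state) x :
    uniq s -> sorted (relpre pos leq) s ->
  circuit s z x *+ #|{ffun I * K -> T}| =
  (\sum_(c : {ffun I * K -> T})
     (\prod_(i <- s)
        A i (pull (row i) (setcols s c x)) (pull (slot i) c)) *
     z (setcols s c x)) *+ (#|{ffun K -> T}| ^ size s).
Proof.
elim: s x => [|i s IHs] x.
  move=> _ _ /=; rewrite expn0 mulr1n -sumr_const; apply: eq_bigr => c _.
  by rewrite big_nil mul1r.
move=> /= /andP[is_ us]; rewrite path_sortedE; last first.
  by move=> a b c; apply: leq_trans.
move=> /andP[ile ss].
have islot : injective (slot i) by move=> j j' [].
(* One factor is spent on splitting off the values of [c] at the slots of [i], which become the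
   variable of the outermost gate. *)
rewrite expnS mulrnA -(sum_setw_const (e := slot i)) //.
rewrite exchange_big /= /gate -!sumrMnl; apply: eq_bigr => g _.
rewrite -mulrnAr IHs // mulrnAr; congr (_ *+ _).
rewrite mulr_sumr; apply: eq_bigr => c _.
rewrite big_cons !pull_setw // setcols_setw // mulrA; congr (_ * _ * _).
  congr (A _ _ _); rewrite setcols_pull_row // pull_setw_out // => j j'.
  by rewrite eq_sym row_coli.
rewrite !big_seq; apply: eq_bigr => i' i's.
by rewrite [in RHS]pull_setw_out // => j j'; apply: contraNneq is_ => -[->].
Qed.

End Circuit.

(** * Bounds on the operator norm *)

Section OperatorNormTheory.
Variable R : realType.

Lemma sqr_l2norm n (x : 'cV[R[i]]_n) : l2norm x ^+ 2 = \sum_i sqn (x i 0).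
Proof. by rewrite sqr_sqrtr // sumr_ge0 // => i _; apply: sqn_ge0. Qed.

Lemma l2norm_ge0 n (x : 'cV[R[i]]_n) : 0 <= l2norm x.
Proof. exact: sqrtr_ge0. Qed.

Lemma l2normZ n (a : R) (x : 'cV[R[i]]_n) :
  0 <= a -> l2norm (a%:C%C *: x) = a * l2norm x.
Proof.
move=> a0; apply: (@pexpIrn _ 2); rewrite ?nnegrE ?mulr_ge0 ?l2norm_ge0 //.
rewrite exprMn !sqr_l2norm mulr_sumr; apply: eq_bigr => i _.
by rewrite mxE sqnM /sqn /= expr0n addr0 sqrtr_sqr real_normK ?num_real.
Qed.

(* The entrywise bound makes the supremum in [opnorm] a genuine one. *)
Lemma opnorm_has_ubound p q (A : 'M[R[i]]_(p, q)) :
  has_ubound [set l2norm (A *m x) | x in [set x | l2norm x <= 1]]%classic.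
Proof.
exists (Num.sqrt (\sum_(i < p) q%:R * \sum_(j < q) sqn (A i j))).
move=> _ [x /= x1 <-].
rewrite ler_sqrt; last first.
  apply: sumr_ge0 => i _; apply: mulr_ge0 => //.
  by apply: sumr_ge0 => j _; apply: sqn_ge0.
apply: ler_sum => i _; rewrite -/(sqn _) mxE.
apply: le_trans (sqn_sum_le _) _; rewrite card_ord ler_wpM2l //.
apply: ler_sum => j _; rewrite sqnM ler_piMr ?sqn_ge0 //.
apply: (@le_trans _ _ (l2norm x ^+ 2)); last by rewrite expr_le1 ?l2norm_ge0.
rewrite sqr_l2norm (bigD1 j) //= lerDl.
by apply: sumr_ge0 => ? _; apply: sqn_ge0.
Qed.

Lemma l2norm_mulmx_le p q (A : 'M[R[i]]_(p, q)) x :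
  opnorm A <= 1 -> l2norm (A *m x) <= l2norm x.
Proof.
move=> A1.
have unit_le y : l2norm y <= 1 -> l2norm (A *m y) <= 1.
  move=> y1; apply: le_trans A1; apply: ub_le_sup.
    exact: opnorm_has_ubound.
  by exists y.
(* Any positive [t] above the norm of [x] is allowed, so that a vector of norm 0 is handled by
   letting [t] tend to 0. *)
have scale_le (t : R) : 0 < t -> l2norm x <= t -> l2norm (A *m x) <= t.
  move=> t0 xt; have ti0 : 0 <= t^-1 by rewrite invr_ge0 ltW.
  have := unit_le (t^-1%:C%C *: x).
  rewrite -scalemxAr !l2normZ // ![t^-1 * _]mulrC !ler_pdivrMr // mul1r.
  exact.
have := l2norm_ge0 x; rewrite le_eqVlt => /predU1P[x0|x0]; last exact: scale_le.
rewrite -x0; apply/ler_addgt0Pl => e e0; rewrite addr0; apply: scale_le => //.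
by rewrite -x0 ltW.
Qed.

Lemma opnorm_le p q (A : 'M[R[i]]_(p, q)) (M : R) : 0 <= M ->
    (forall x : 'cV_q,
       \sum_i sqn ((A *m x) i 0) <= M ^+ 2 * \sum_j sqn (x j 0)) ->
  opnorm A <= M.
Proof.
move=> M0 AM; apply: ge_sup.
  exists (l2norm (A *m (0 : 'cV_q))); exists 0 => //=.
  rewrite /l2norm big1 ?sqrtr0 // => i _.
  by rewrite mxE ComplexField.Normc.normc0 expr0n.
move=> _ [x /= x1 <-]; rewrite -ler_sqr ?nnegrE ?l2norm_ge0 // sqr_l2norm.
apply: le_trans (AM x) _; rewrite -sqr_l2norm ler_piMr ?sqr_ge0 //.
by rewrite expr_le1 ?l2norm_ge0.
Qed.

End OperatorNormTheory.

(** * Arcs and slots of a partial trace *)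

Section PartialTraceBound.
Variables (R : realType) (N k n : nat) (rho : 'I_k -> pperm n).
Variable pos : 'I_n -> nat.

Local Notation slots := ('I_n * 'I_k)%type.
Local Notation conf := {ffun slots -> 'I_N}.

(** An arc is named after its column slot. Equal positions count as backward, which covers the fixed
    points of [rho]. *)
Definition backward : {set slots} :=
  [set s | if rho s.2 s.1 is Some i then (pos i <= pos s.1)%N else false].

Definition source (s : slots) : option 'I_n :=
  [pick i | rho s.2 i == Some s.1].

(** The default [s.1] is a dummy value for slots where no arc starts. *)
Definition target (s : slots) : slots := (odflt s.1 (rho s.2 s.1), s.2).

Lemma sourceP i i' j : (source (i', j) == Some i) = (rho j i == Some i').
Proof.
rewrite /source /=; case: pickP => [i0 /eqP e0|/(_ i) -> //].
apply/eqP/eqP => [[<-] //|e]; congr Some; exact: pp_inj e0 e.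
Qed.

Lemma source_free s : (source s == None) = (s \in free_row rho).
Proof.
case: s => i j; rewrite inE /= inE /source /=; case: pickP => [i0 e0|no].
  by apply/esym/negbF/existsP; exists i0.
by apply/esym/negbT/negbTE/existsP => -[i0]; rewrite no.
Qed.

Lemma target_inj : {in ~: free_col rho &, injective target}.
Proof.
move=> [i j] [i' j']; rewrite !inE /target /= !negbK => bi bi' [+ jj'].
subst j'; move: bi bi'.
case e: (rho j i) => [l|//]; case e': (rho j i') => [l'|//] _ _ /= ll'.
by subst l'; congr pair; apply: pp_inj e e'.
Qed.

Lemma backward_dom s : s \in backward -> s \in ~: free_col rho.
Proof. by rewrite !inE; case: (rho _ _). Qed.

(** [target] injects the column slots that carry an arc into the row slots that receive one, and
    there are as many row slots as column slots. *)
Lemma card_free : (#|free_row rho| <= #|free_col rho|)%N.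
Proof.
rewrite -[leqRHS]addn0 -(leq_add2r #|~: free_row rho|) cardsC addn0.
rewrite -(cardsC (free_col rho)) leq_add2l.
rewrite -(card_in_imset target_inj) subset_leq_card //.
apply/fintype.subsetP=> s.
case/imsetP=> -[i j]; rewrite !inE /= negbK => + ->.
case e: (rho j i) => [l|//] _; rewrite /target /= e /= negbK.
by apply/existsP; exists i; rewrite e.
Qed.

(** Only the values of [a] at free row slots matter. *)
Definition row_values (a c : conf) : conf :=
  [ffun s => if source s is Some i then c (i, s.2) else a s].

(** Given [c], the arcs and [a] determine [r], and [b] is read off [c]; a sum over compatible
    indices is thus a sum over [c] alone. *)
Lemma ptrace_compatE (a c r : conf) (b : col_index N rho) :
  ptrace_compat (pull val a) b r c =
  (r == row_values a c) && (b == pull val c).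
Proof.
apply/and3P/andP => [[/forallP rc /forallP ra /forallP cb]|[/eqP -> /eqP ->]].
  split; apply/eqP/ffunP => s; rewrite ffunE.
    case: s => i' j; case e: (source _) => [i|].
      move/eqP: e; rewrite sourceP => e.
      by move: (rc j) => /forallP/(_ i)/forallP/(_ i')/implyP/(_ e)/eqP.
    move/eqP: e; rewrite source_free => sfree.
    by have := ra (exist _ (i', j) sfree); rewrite ffunE => /eqP.
  by have /eqP := cb s.
split.
- apply/forallP=> j; apply/forallP=> i; apply/forallP=> i'; apply/implyP.
  by rewrite -sourceP ffunE => /eqP ->.
- apply/forallP=> -[s /= sfree]; rewrite !ffunE /=.
  by move: sfree; rewrite -source_free => /eqP ->.
- by apply/forallP=> s; rewrite !ffunE.
Qed.

Variable A : 'I_n -> tensor_mx R[i] N k.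

Lemma mul_ptraceE (a : conf) (z : 'cV[R[i]]_#|col_index N rho|) :
  (ptrace rho A *m z) (enum_rank (pull val a : row_index N rho)) 0 =
  \sum_(c : conf)
    (\prod_i tentry (A i) (pull (slot i) (row_values a c)) (pull (slot i) c)) *
    z (enum_rank (pull val c : col_index N rho)) 0.
Proof.
pose term (b : col_index N rho) (r c : conf) : R[i] :=
  if (r == row_values a c) && (b == pull val c) then
    (\prod_i tentry (A i) (pull (slot i) r) (pull (slot i) c)) *
    z (enum_rank b) 0
  else 0.
rewrite mxE (reindex (@enum_rank (col_index N rho))) /=; last first.
  by apply: onW_bij; apply: enum_rank_bij.
under eq_bigr => b _.
  rewrite mxE !enum_rankK mulr_suml big_mkcond /=.
  rewrite (eq_bigr (fun rc => term b rc.1 rc.2)); last first.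
    by move=> rc _; rewrite ptrace_compatE.
  over.
rewrite exchange_big /= -(pair_bigA _ (fun r c => \sum_b term b r c)) /=.
rewrite exchange_big /=; apply: eq_bigr => c _.
rewrite (big_only1 (row_values a c)) //=; last first.
  by move=> r /negbTE rN _; rewrite big1 // => b _; rewrite /term rN.
rewrite (big_only1 (pull val c)) //=; last first.
  by move=> b /negbTE bN _; rewrite /term bN andbF.
by rewrite /term !eqxx.
Qed.

(** * The circuit of a partial trace *)

Local Notation wires := (slots + slots)%type.

(* A forward arc is a single wire, named after its column slot; a row slot that
   is free or the end of a backward arc is a wire of its own. *)
Definition row_wire (i : 'I_n) (j : 'I_k) : wires :=
  if source (i, j) is Some i0 then
    if (pos i0 < pos i)%N then inr (i0, j) else inl (i, j)
  else inl (i, j).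

Definition col_wire (i : 'I_n) (j : 'I_k) : wires := inr (i, j).

Variant row_wire_spec i j : wires -> Type :=
| RowForward i0 of rho j i0 = Some i & (pos i0 < pos i)%N :
    row_wire_spec i j (inr (i0, j))
| RowBackward i0 of rho j i0 = Some i & (pos i <= pos i0)%N :
    row_wire_spec i j (inl (i, j))
| RowFree of (i, j) \in free_row rho : row_wire_spec i j (inl (i, j)).

Lemma row_wireP i j : row_wire_spec i j (row_wire i j).
Proof.
rewrite /row_wire; case e: source => [i0|].
  move/eqP: e; rewrite sourceP => /eqP e.
  by case: ltnP => p0; [apply: RowForward | apply: RowBackward e p0].
by apply: RowFree; rewrite -source_free e.
Qed.

Lemma row_wire_inj i i' j j' :
  row_wire i j = row_wire i' j' -> (i, j) = (i', j').
Proof.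
case: row_wireP => [i0 e _|? _ _|_]; case: row_wireP => [i1 e' _|? _ _|_] //.
- by case=> ? ?; subst i1 j'; move: e'; rewrite e => -[->].
- by case=> -> ->.
- by case=> -> ->.
- by case=> -> ->.
- by case=> -> ->.
Qed.

Lemma col_wire_inj i i' j j' :
  col_wire i j = col_wire i' j' -> (i, j) = (i', j').
Proof. by case=> -> ->. Qed.

Lemma row_col_wire i i' j j' :
  row_wire i j = col_wire i' j' -> (pos i' < pos i)%N.
Proof. by case: row_wireP => // i0 _ p0 [<-]. Qed.

Definition order : seq 'I_n := sort (relpre pos leq) (enum 'I_n).

Lemma order_uniq : uniq order.
Proof. by rewrite sort_uniq enum_uniq. Qed.

Lemma order_sorted : sorted (relpre pos leq) order.
Proof. by apply: sort_sorted => i j; apply: leq_total. Qed.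

Lemma mem_order i : i \in order.
Proof. by rewrite mem_sort mem_enum. Qed.

Lemma size_order : size order = n.
Proof. by rewrite size_sort size_enum_ord. Qed.

Definition join (x : {ffun wires -> 'I_N}) (c : conf) : {ffun wires -> 'I_N} :=
  [ffun w => if w is inr s then c s else x w].

Lemma setcols_order c x : setcols col_wire order c x = join x c.
Proof.
have setcolsE s y : setcols col_wire s c y = [ffun w =>
    if w is inr s0 then if s0.1 \in s then c s0 else y w else y w].
  elim: s y => [|i s IHs] y /=.
    by apply/ffunP=> -[] s0; rewrite ffunE.
  rewrite IHs; apply/ffunP=> -[] s0; rewrite [LHS]ffunE [RHS]ffunE.
    by rewrite setw_out.
  rewrite inE; case: ifP => [|s0s]; first by rewrite orbT.
  rewrite orbF; case: eqP => [<-|/eqP s0i].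
    by case: s0 {s0s} => i0 j0; rewrite (setw_in _ _ j0) ?ffunE // => ? ? [].
  by rewrite setw_out // => j; apply: contraNneq s0i => -[<-].
rewrite setcolsE; apply/ffunP=> -[] s; rewrite !ffunE //.
by rewrite mem_order.
Qed.

Local Notation back_index := {ffun {s | s \in backward} -> 'I_N}.

Definition free_col_wire (s : {s | s \in free_col rho}) : wires := inr (val s).
(** A backward arc is cut into two wires: its column end on the right, its row end on the left. *)
Definition back_col_wire (s : {s | s \in backward}) : wires := inr (val s).
Definition back_row_wire (s : {s | s \in backward}) : wires :=
  inl (target (val s)).
Definition free_row_wire (s : {s | s \in free_row rho}) : wires := inl (val s).

Lemma free_col_wire_inj : injective free_col_wire.
Proof. exact: inj_comp inr_inj val_inj. Qed.

Lemma back_row_wire_inj : injective back_row_wire.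
Proof.
move=> s s' ss'; apply: val_inj.
by apply: target_inj (inl_inj ss'); apply/backward_dom/valP.
Qed.

Lemma free_row_wire_inj : injective free_row_wire.
Proof. exact: inj_comp inl_inj val_inj. Qed.

Variable z : 'cV[R[i]]_#|col_index N rho|.

(* The input vector, with the backward arcs carrying the values [v]. *)
Definition start (v : back_index) (x : {ffun wires -> 'I_N}) : R[i] :=
  if pull back_col_wire x == v then
    z (enum_rank (pull free_col_wire x : col_index N rho)) 0
  else 0.

(** A wire [inr s] is the output of a gate only if [s] is a forward arc, so [start] reads no output
    wire. *)
Lemma start_indep v i : indep row_wire i (start v).
Proof.
have rowN s j : s \in free_col rho \/ s \in backward ->
    row_wire i j != inr s.
  case: row_wireP => // i0 e p0 sP; apply/eqP => -[es]; subst s.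
  by case: sP; rewrite !inE /= ?inE e //= leqNgt p0.
move=> x x' xx'; rewrite /start.
have -> : pull back_col_wire x = pull back_col_wire x'.
  by apply/ffunP=> -[s sb]; rewrite !ffunE xx' // => j; apply: rowN; right.
have -> // : pull free_col_wire x = pull free_col_wire x'.
by apply/ffunP=> -[s sb]; rewrite !ffunE xx' // => j; apply: rowN; left.
Qed.

Definition amplitude (v : back_index) : {ffun wires -> 'I_N} -> R[i] :=
  circuit (fun i => tentry (A i)) row_wire col_wire order (start v).

Hypothesis N_gt0 : (0 < N)%N.

Lemma card_ffun_gt0 (S : finType) : (0 < #|{ffun S -> 'I_N}|)%N.
Proof. by rewrite card_ffun card_ord expn_gt0 N_gt0. Qed.

Lemma amplitudeE v x : amplitude v x =
  \sum_(c : conf)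
    (\prod_i tentry (A i) (pull (row_wire i) (join x c)) (pull (slot i) c)) *
    start v (join x c).
Proof.
rewrite /amplitude; have := @circuitE _ _ _ _ _ (fun i => tentry (A i)) _ _
  _ row_col_wire _ (start v) x order_uniq order_sorted.
(* All gates take part, so the two multiplicities of [circuitE] agree and cancel. *)
have -> : #|conf| = (#|{ffun 'I_k -> 'I_N}| ^ size order)%N.
  by rewrite size_order !card_ffun card_prod !card_ord mulnC expnM.
have K0 : (0 < #|{ffun 'I_k -> 'I_N}| ^ size order)%N.
  by rewrite expn_gt0 card_ffun_gt0.
move=> /(pmulrnI K0) ->; apply: eq_bigr => c _; rewrite setcols_order.
congr (_ * _); apply: perm_big.
apply: uniq_perm; rewrite ?order_uniq ?index_enum_uniq // => i.
by rewrite mem_order mem_index_enum.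
Qed.

(** [setw] puts [v] on the row ends of the backward arcs and [start] demands it on their column
    ends; summing over [v] glues the two ends together. *)
Lemma mul_ptrace_amplitude x :
  (ptrace rho A *m z) (enum_rank (pull free_row_wire x : row_index N rho)) 0 =
  \sum_v amplitude v (setw back_row_wire v x).
Proof.
have -> : pull free_row_wire x =
    pull val ([ffun s => x (inl s)] : conf) :> {ffun _ -> 'I_N}.
  by apply/ffunP=> s; rewrite !ffunE.
rewrite mul_ptraceE.
under [RHS]eq_bigr => v _ do rewrite amplitudeE.
rewrite exchange_big /=; apply: eq_bigr => c _.
have back_join y : pull back_col_wire (join y c) = pull val c.
  by apply/ffunP=> s; rewrite !ffunE.
rewrite (big_only1 (pull val c)) //=; last first.
  move=> v vc _; rewrite /start back_join eq_sym (negbTE vc) mulr0 //.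
rewrite /start back_join eqxx; congr (_ * z (enum_rank _) 0); last first.
  by apply/ffunP=> s; rewrite !ffunE.
apply: eq_bigr => i _; congr tentry; apply/ffunP=> j.
rewrite [LHS]ffunE [RHS]ffunE [LHS]ffunE [RHS]ffunE /slot /=.
case: row_wireP => [i0 e _|i0 e p0|ij].
- by move/eqP: e; rewrite -sourceP => /eqP ->.
- have sb : (i0, j) \in backward by rewrite inE /= e.
  have -> : inl (i, j) = back_row_wire (exist _ (i0, j) sb).
    by rewrite /back_row_wire /target /= e.
  rewrite (setw_in _ _ _ back_row_wire_inj) [RHS]ffunE /=.
  by move/eqP: e; rewrite -sourceP => /eqP ->.
- rewrite setw_out; last first.
    case=> -[i0 j0] sb; apply/eqP => -[] /=; move: sb; rewrite !inE /=.
    case e: (rho j0 i0) => [i1|//] _ /= ? ?; subst i1 j0.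
    move: ij; rewrite -source_free => /eqP ij.
    by move/eqP: e; rewrite -sourceP ij.
  by move: ij; rewrite -source_free => /eqP ->; rewrite ffunE.
Qed.

Hypothesis A_le1 : forall i, opnorm (A i) <= 1.

Lemma tentry_contr i (f : {ffun 'I_k -> 'I_N} -> R[i]) :
  \sum_r sqn (\sum_c tentry (A i) r c * f c) <= \sum_c sqn (f c).
Proof.
pose x : 'cV[R[i]]_#|multi_index N k| := \col_l f (enum_val l).
have rank_bij : {on xpredT, bijective (@enum_rank (multi_index N k))}.
  exact/onW_bij/enum_rank_bij.
have := l2norm_mulmx_le x (A_le1 i).
rewrite -ler_sqr ?nnegrE ?l2norm_ge0 // !sqr_l2norm.
congr (_ <= _); rewrite (reindex _ rank_bij) /=; apply: eq_bigr => r _.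
  rewrite mxE (reindex _ rank_bij) /=; congr sqn; apply: eq_bigr => c _.
  by rewrite mxE enum_rankK.
by rewrite mxE enum_rankK.
Qed.

Lemma amplitude_le v :
  \sum_x sqn (amplitude v x) <= \sum_x sqn (start v x).
Proof.
apply: (circuit_contr tentry_contr row_wire_inj col_wire_inj row_col_wire).
- exact: order_uniq.
- exact: start_indep.
- exact: card_ffun_gt0.
Qed.

(** Of the two factors N^#|backward|, one comes from Cauchy-Schwarz in [v], the other from
    decoupling [v] from the values on the row ends. *)
Lemma sum_sqn_ptrace :
  \sum_a sqn ((ptrace rho A *m z) a 0) <=
  ((N ^ #|backward|)%:R) ^+ 2 * \sum_b sqn (z b 0).
Proof.
have qWgt0 : (0 : R) < #|{ffun wires -> 'I_N}|%:R.
  by rewrite ltr0n card_ffun_gt0.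
have qB : #|back_index| = (N ^ #|backward|)%N.
  by rewrite card_ffun card_ord card_sig; congr (_ ^ _)%N; apply: eq_card.
pose y (a : row_index N rho) := sqn ((ptrace rho A *m z) (enum_rank a) 0).
have rowsum := sum_pull y free_row_wire_inj.
pose u (b : col_index N rho) := sqn (z (enum_rank b) 0).
have colsum := sum_pull u free_col_wire_inj.
have main : \sum_x y (pull free_row_wire x) <=
    (#|back_index|%:R) ^+ 2 * \sum_x u (pull free_col_wire x).
  rewrite expr2 -mulrA.
  apply: (@le_trans _ _ (#|back_index|%:R *
      \sum_x \sum_v sqn (amplitude v (setw back_row_wire v x)))).
    rewrite mulr_sumr; apply: ler_sum => x _; rewrite /y mul_ptrace_amplitude.
    exact: sqn_sum_le.
  rewrite ler_wpM2l ?ler0n //.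
  (* After this exchange [v] is read off [x] and the inner variable is idle: summing over it gives
     the second factor. *)
  rewrite (sum_setw (fun _ v x => sqn (amplitude v x)) back_row_wire_inj) /=.
  apply: (@le_trans _ _ (#|back_index|%:R *
      \sum_v \sum_x sqn (amplitude v x))).
    rewrite [X in _ <= _ * X]exchange_big /= mulr_sumr; apply: ler_sum => x _.
    rewrite sumr_const -[_ *+ _]mulr_natl ler_wpM2l ?ler0n //.
    rewrite (bigD1 (pull back_row_wire x)) //= lerDl.
    by apply: sumr_ge0 => v _; apply: sqn_ge0.
  rewrite ler_wpM2l ?ler0n //.
  apply: le_trans (ler_sum _ (fun v _ => amplitude_le v)) _.
  rewrite exchange_big /=; apply: ler_sum => x _.
  (* Each [x] meets the condition of [start] for exactly one [v]. *)
  rewrite (big_only1 (pull back_col_wire x)) //=; last first.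
    by move=> v vx _; rewrite /start eq_sym (negbTE vx) sqn0.
  by rewrite /start eqxx.
(* Sums over all wires repeat an output over the wires other than free row slots, and an input over
   those other than free column slots; this compares the two multiplicities. *)
have row_le_col : (#|row_index N rho| <= #|col_index N rho|)%N.
  rewrite !card_ffun card_ord !card_sig leq_pexp2l //.
  rewrite (eq_card (B := mem (free_row rho))) //.
  by rewrite [leqRHS](eq_card (B := mem (free_col rho))) // card_free.
have rank_bij (S : finType) : {on xpredT, bijective (@enum_rank S)}.
  exact/onW_bij/enum_rank_bij.
rewrite (reindex _ (rank_bij (row_index N rho))) /= -/(y _).
rewrite [X in _ <= _ * X](reindex _ (rank_bij (col_index N rho))) /= -/(u _).
rewrite -(ler_pM2l qWgt0) mulr_natl -rowsum.
rewrite mulrCA [X in _ * X]mulr_natl -colsum.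
rewrite -[leLHS]mulr_natl -[X in _ <= _ * X]mulr_natl mulrCA -qB.
apply: (@le_trans _ _
  (#|col_index N rho|%:R * \sum_x y (pull free_row_wire x))).
  rewrite ler_wpM2r ?ler_nat //.
  by apply: sumr_ge0 => x _; apply: sqn_ge0.
by rewrite ler_wpM2l ?ler0n.
Qed.

End PartialTraceBound.

Theorem opnorm_ptrace (R : realType) (N k n : nat) (rho : 'I_k -> pperm n)
    (pos : 'I_n -> nat) (A : 'I_n -> tensor_mx R[i] N k) :
  (0 < N)%N -> (forall i, opnorm (A i) <= 1) ->
  opnorm (ptrace rho A) <= (N ^ #|backward rho pos|)%:R.
Proof.
move=> N0 A1; apply: opnorm_le; first exact: ler0n.
by move=> z; apply: sum_sqn_ptrace.
Qed.

(** * Counting backward arcs *)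

Definition back_count n (rho : pperm n) (pos : 'I_n -> nat) : nat :=
  \sum_i (if rho i is Some i' then (pos i' <= pos i)%N else false).

Lemma card_backward n k (rho : 'I_k -> pperm n) pos :
  #|backward rho pos| = (\sum_j back_count (rho j) pos)%N.
Proof.
rewrite -sum1_card big_mkcond /= /back_count exchange_big pair_bigA /=.
by apply: eq_bigr => s _; rewrite inE; case: (rho _ _) => [i|] //=; case: ifP.
Qed.

Lemma card_backward_sigma_tau m (theta : 'S_m) d1 d2 pos :
  #|backward (sigma_tau_family theta d1 d2) pos| =
  (d1 * back_count (pperm_of_perm (sigma theta)) pos +
   d2 * back_count (tau m) pos)%N.
Proof.
rewrite card_backward big_split_ord /=; congr (_ + _)%N.
  rewrite (eq_bigr (fun=> back_count (pperm_of_perm (sigma theta)) pos)).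
    by rewrite sum_nat_const card_ord.
  by move=> j _; rewrite /sigma_tau_family /= ltn_ord.
rewrite (eq_bigr (fun=> back_count (tau m) pos)) => [|j _].
  by rewrite sum_nat_const card_ord.
by rewrite /sigma_tau_family /= ltnNge leq_addr.
Qed.

Section Counting.
Variables (m : nat) (theta : 'S_m).

(** Positions are grouped by the pairs of the pairing, whose two arcs under [sigma] are bounded
    together. *)
Lemma sum_odd_even (F : 'I_(2 * m) -> nat) :
  (\sum_x F x = \sum_i (F (odd_pos i) + F (even_pos (theta i))))%N.
Proof.
have -> : (\sum_i (F (odd_pos i) + F (even_pos (theta i))) =
    \sum_i (F (odd_pos i) + F (even_pos i)))%N.
  by rewrite !big_split /= [X in _ = (_ + X)%N](reindex_perm theta).
pose h (bi : bool * 'I_m) := if bi.1 then even_pos bi.2 else odd_pos bi.2.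
pose h' (x : 'I_(2 * m)) := (odd x, half_pos x).
have hK : cancel h h'.
  by move=> [[] i]; congr pair; rewrite /h /=; try apply: val_inj => /=; lia.
have Kh : cancel h' h.
  by move=> x; rewrite /h /=; case: ifP => /= ox; apply: val_inj => /=; lia.
rewrite (reindex h) /=; last by apply: onW_bij; exists h'.
rewrite -(pair_bigA _ (fun b i => F (h (b, i)))) /= big_bool.
by rewrite /= big_split addnC.
Qed.

(** [sigma] maps a position to the cyclic successor of its partner in the pairing; the value 0 is
    the wrap-around, met when the partner is the last position. *)
Lemma sigma_odd_pos (i : 'I_m) :
  sigma theta (odd_pos i) =
    (if (theta i).+1 == m then 0 else (2 * theta i).+2) :> nat.
Proof.
rewrite permE /sigma_fun /= oddM /= (_ : half_pos (odd_pos i) = i); last first.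
  by apply: val_inj => /=; lia.
case: eqP => [->|im]; first by rewrite modnn muln0.
by rewrite modn_small; have := ltn_ord (theta i); lia.
Qed.

Lemma sigma_even_pos (i : 'I_m) :
  sigma theta (even_pos (theta i)) = (2 * i).+1 :> nat.
Proof.
rewrite permE /sigma_fun /= oddM /=.
rewrite (_ : half_pos (even_pos (theta i)) = theta i); last first.
  by apply: val_inj => /=; lia.
by rewrite /sigma'' permK.
Qed.

Lemma sum_theta_last : (\sum_i ((theta i).+1 == m) <= 1)%N.
Proof.
have -> : (\sum_i ((theta i).+1 == m) = \sum_(i < m) (i.+1 == m))%N.
  by rewrite [RHS](reindex_perm theta).
case: m => [|m']; first by rewrite big_ord0.
rewrite (big_only1 ord_max) //= ?eqxx // => i + _.
by rewrite -val_eqE /= eqSS => /negbTE ->.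
Qed.

Lemma back_count_sigma (pos : nat -> nat) :
  back_count (pperm_of_perm (sigma theta)) (fun x => pos x) =
  (\sum_i ((pos (if (theta i).+1 == m then 0 else (2 * theta i).+2)
              <= pos (2 * i)) +
          (pos (2 * i).+1 <= pos (2 * theta i).+1)))%N.
Proof.
rewrite /back_count sum_odd_even /=; apply: eq_bigr => i _.
by rewrite sigma_odd_pos sigma_even_pos.
Qed.

(** For partners p and q the arcs go from p to q + 1 and from q to p + 1; just one is backward,
    unless one of them wraps around, which happens for at most one pair. *)
Lemma back_count_sigma_id :
  (back_count (pperm_of_perm (sigma theta)) (fun x => x) <= m.+1)%N.
Proof.
rewrite (back_count_sigma id) -(addn1 m).
apply: leq_trans _ (leq_add (leqnn m) sum_theta_last).
rewrite -[X in (_ <= X + _)%N]card_ord -sum1_card -big_split /=.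
by apply: leq_sum => i _; case: eqP => _ /=; lia.
Qed.

Lemma back_count_tau (pos : nat -> nat) :
  (back_count (tau m) (fun x => pos x)
     <= \sum_(x < 2 * m) (pos x.+1 <= pos x))%N.
Proof.
apply: leq_sum => x _; rewrite /= /tau_fun; case: insubP => // u _ ->.
by [].
Qed.

Lemma back_count_tau_id : back_count (tau m) (fun x => x) = 0%N.
Proof.
apply/eqP; rewrite -leqn0 (leq_trans (back_count_tau id)) // big1 // => x _.
by rewrite ltnn.
Qed.

(** The place of [x] once the consecutive blocks ]a, c] and ]c, b] are exchanged. *)
Definition block_swap (a c b x : nat) : nat :=
  if (a < x <= c)%N then (x + (b - c))%N
  else if (c < x <= b)%N then (x - (c - a))%N else x.

Variant block_swap_spec a c b x : nat -> Prop :=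
| BlockSwapLeft of (a < x <= c)%N : block_swap_spec a c b x (x + (b - c))
| BlockSwapRight of (c < x <= b)%N & ~~ (a < x <= c)%N :
    block_swap_spec a c b x (x - (c - a))
| BlockSwapOut of ~~ (c < x <= b)%N & ~~ (a < x <= c)%N :
    block_swap_spec a c b x x.

Lemma block_swapP a c b x : block_swap_spec a c b x (block_swap a c b x).
Proof.
rewrite /block_swap; case: ifP => [|/negbT ?]; first by constructor.
by case: ifP => [?|/negbT ?]; constructor.
Qed.

(** The only descent from x to x + 1 is at c, which lands on b while c + 1 lands on a + 1. *)
Lemma back_count_tau_swap a (c : 'I_(2 * m)) b : (a < c < b)%N ->
  (back_count (tau m) (fun x => block_swap a c b x) <= 1)%N.
Proof.
move=> acb; apply: leq_trans (back_count_tau _) _.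
have c1 : (\sum_(x < 2 * m) (x == c) = 1)%N.
  by rewrite (big_only1 c) ?eqxx // => x /negbTE ->.
rewrite -[leqRHS]c1; apply: leq_sum => x _.
have [_|xc] := eqVneq x c; first exact: leq_b1.
move: xc; rewrite -val_eqE leqn0 eqb0 -ltnNge /=.
by case: block_swapP; case: block_swapP; lia.
Qed.

(** Away from c the new place of x + 1 exceeds that of x, so two backward arcs would make each of p
    and q precede the other. If one of them is c, the other lies beyond b, where nothing moves, and
    the arc from c is forward. *)
Lemma block_swap_pair a c b p q : (a < c < b)%N -> p != q -> p != b -> q != b ->
  (p = c -> b < q)%N -> (q = c -> b < p)%N ->
  ((block_swap a c b q.+1 <= block_swap a c b p) +
   (block_swap a c b p.+1 <= block_swap a c b q) <= 1)%N.
Proof.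
by do 4!case: block_swapP; lia.
Qed.

Lemma mem_pairing (x y : 'I_(2 * m)) : [set x; y] \in pairing theta ->
  exists i, (x = odd_pos i /\ y = even_pos (theta i)) \/
            (x = even_pos (theta i) /\ y = odd_pos i).
Proof.
case/imsetP=> i _ xyE; exists i.
have odd_even : odd_pos i != even_pos (theta i).
  by apply/eqP => /(congr1 val) /=; lia.
have : x \in [set odd_pos i; even_pos (theta i)] by rewrite -xyE !inE eqxx.
have : y \in [set odd_pos i; even_pos (theta i)] by rewrite -xyE !inE eqxx orbT.
have : odd_pos i \in [set x; y] by rewrite xyE !inE eqxx.
have : even_pos (theta i) \in [set x; y] by rewrite xyE !inE eqxx orbT.
rewrite !inE => ex ox /orP[]/eqP yE /orP[]/eqP xE; move: ex ox;
  rewrite xE yE ?[even_pos _ == odd_pos _]eq_sym ?(negbTE odd_even) //.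
- by move=> _ _; right.
- by move=> _ _; left.
Qed.

(** Both arcs of {a, b} become forward: b + 1 stays beyond a, and a + 1 lands just after b. The
    other m - 1 pairs give one each, plus one for the wrap-around. *)
Lemma back_count_sigma_swap (a b c d : 'I_(2 * m)) :
    [set a; b] \in pairing theta -> [set c; d] \in pairing theta ->
    (a < c < b)%N -> (b < d)%N ->
  (back_count (pperm_of_perm (sigma theta)) (fun x => block_swap a c b x)
     <= m)%N.
Proof.
move=> /mem_pairing[i0 ab] /mem_pairing[i1 cd] acb bd.
rewrite (back_count_sigma (block_swap a c b)).
have m_gt0 : (0 < m)%N by have := ltn_ord i0; lia.
apply: (@leq_trans (\sum_i ((i != i0) + ((theta i).+1 == m)))%N); last first.
  rewrite big_split /=.
  have : (\sum_i (i != i0) = m.-1)%N.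
    rewrite -big_mkcond /= sum1_card (eq_card (B := predC1 i0)) //.
    by rewrite cardC1 card_ord.
  move=> ->; rewrite (leq_trans (leq_add (leqnn _) sum_theta_last)) //.
  by rewrite addn1 prednK.
apply: leq_sum => i _.
have [->|ii0] := eqVneq i i0.
  (* Neither a nor b is the last position, as both lie below d. *)
  have -> : (theta i0).+1 == m = false.
    have := ltn_ord d; case: ab => -[/(congr1 val)/= ? /(congr1 val)/= ?]; lia.
  case: ab => -[/(congr1 val)/= ? /(congr1 val)/= ?];
    do 4!case: block_swapP; lia.
have thi : theta i != theta i0 by apply: contraNneq ii0 => /perm_inj ->.
case: eqP => _; first exact: leq_add (leq_b1 _) (leq_b1 _).
rewrite addn0; apply: block_swap_pair => //.
- lia.
- apply/eqP; move: ii0 thi.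
  by case: ab => -[/(congr1 val)/= ? /(congr1 val)/= ?];
    rewrite -!val_eqE /=; lia.
- apply/eqP; move: ii0 thi.
  by case: ab => -[/(congr1 val)/= ? /(congr1 val)/= ?];
    rewrite -!val_eqE /=; lia.
(* The partner of c is d, which lies beyond b. *)
- case: cd => -[/(congr1 val)/= ? /(congr1 val)/= ?] ic; last lia.
  have ->: i = i1 by apply: val_inj => /=; lia.
  lia.
- case: cd => -[/(congr1 val)/= ? /(congr1 val)/= ?] ic; first lia.
  have : theta i = theta i1 by apply: val_inj => /=; lia.
  move=> /perm_inj ->; lia.
Qed.

End Counting.

Theorem theorem8 (R : realType) (m N d1 d2 : nat) (theta : 'S_m) :
  (1 <= m)%N -> (1 <= N)%N -> (1 <= d1)%N -> (1 <= d2)%N ->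
  crossing theta ->
  forall A : 'I_(2 * m) -> tensor_mx R[i] N (d1 + d2),
    (forall i, opnorm (A i) <= 1) ->
    opnorm (ptrace (sigma_tau_family theta d1 d2) A)
      <= (N ^ (d1 * m + minn d1 d2))%:R.
Proof.
move=> _ N0 _ _ [a [b [c [d [ab cd /andP[acb bd]]]]]] A A1.
suff [pos posP] : exists pos,
    (#|backward (sigma_tau_family theta d1 d2) pos| <= d1 * m + minn d1 d2)%N.
  by apply: le_trans (opnorm_ptrace _ pos N0 A1) _; rewrite ler_nat leq_pexp2l.
case: (leqP d1 d2) => d12.
  exists (fun x => x); rewrite card_backward_sigma_tau back_count_tau_id.
  by rewrite muln0 addn0 addnC -mulnS leq_mul2l back_count_sigma_id orbT.
exists (fun x => block_swap a c b x); rewrite card_backward_sigma_tau.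
rewrite leq_add ?leq_mul2l ?(back_count_sigma_swap ab cd) ?orbT //.
by rewrite -[leqRHS]muln1 leq_mul2l back_count_tau_swap ?orbT.
Qed.
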